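(* Let $(a_k)_{k\geq 0}$ be Sylvester's sequence, $a_0=2$ and $a_{k+1}=1+\prod_{i=0}^{k}a_i$ for $k\geq 0$. Let $n\geq 1$ be an integer and let $R$ be a fusion ring of rank $n+1$. Then the formal codegrees of $R$ include $a_0,a_1,\ldots,a_{n-1}$ if and only if $R$ is isomorphic, as a fusion ring, to the greedy fusion ring $R_n$.
   Context: **Fusion rings.** A fusion ring is an associative ring $R$ with identity $1_R$, free of finite rank as an abelian group, with a distinguished finite $\mathbb{Z}$-basis $B\ni 1_R$ such that for $b_j,b_k\in B$, $b_jb_k=\sum_\ell c_{j,k}^\ell b_\ell$ with all $c_{j,k}^\ell\in\mathbb{Z}_{\geq 0}$, together with an involution $b\mapsto b^\ast$ of $B$ which extends linearly to an anti-involution of the ring $R$ and such that, for $b,b'\in B$, the coefficient of $1_R$ in $bb'$ is $1$ if $b'=b^\ast$ and $0$ otherwise. The rank of $R$ is $|B|$. Isomorphisms of fusion rings are ring isomorphisms that map distinguished basis bijectively to distinguished basis. **Formal codegrees.** For each irreducible complex representation $\varphi$ of $R\otimes_{\mathbb{Z}}\mathbb{C}$ (up to isomorphism), the element $\sum_{b\in B}\mathrm{Tr}(\varphi(b))\,b^\ast$ acts on $\varphi$ by a positive real scalar $f_\varphi$, called the formal codegree of $\varphi$. If $\varphi:R\to\mathbb{C}$ is a ring homomorphism (one-dimensional representation), then $f_\varphi=\sum_{b\in B}\varphi(b)\varphi(b^\ast)=\sum_{b\in B}|\varphi(b)|^2$. The formal codegrees of $R$ are the numbers $f_\varphi$ over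 all irreducible $\varphi$, each $f_\varphi$ counted with multiplicity $\dim(\varphi)$. Saying that the formal codegrees include given numbers means each of these numbers equals $f_\varphi$ for some irreducible $\varphi$. **Greedy fusion rings.** Put $d_0=1$ and $d_k=a_{k-1}-1$ for $k\geq 1$. For $n\geq 1$, the greedy fusion ring $R_n$ is the commutative fusion ring of rank $n+1$ with basis $r_0=1,r_1,\ldots,r_n$, trivial duality $r_k^\ast=r_k$, and products $$r_jr_k=r_kr_j=d_j\,r_k\quad(0\leq j<k\leq n),\qquad r_kr_k=(a_{k-1}-2)\,r_k+\sum_{j=0}^{k-1}d_j\,r_j\quad(1\leq k\leq n).$$ Here $d_k$ is the Frobenius-Perron dimension of $r_k$ (the Frobenius-Perron dimension is the unique ring homomorphism to $\mathbb{C}$ that is nonnegative on the basis). In particular $R_1\cong\mathbb{Z}C_2$, the integral group ring of the group of order $2$. *)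

(* Defs.v *)
From HB Require Import structures.
From mathcomp Require Import all_boot all_order all_algebra.
From mathcomp Require Import zify.

Set Implicit Arguments.
Unset Strict Implicit.
Unset Printing Implicit Defensive.

Import GRing.Theory.
Local Open Scope ring_scope.

(* The distinguished basis is a family indexed by a finite type; it is
   injective because it is a Z-basis. The structure constants, the duality and
   its additive extension to the ring are all determined by the basis. *)
Record fusion_ring := FusionRing {
  fus_ring :> nzRingType;
  fus_idx : finType;
  fus_basis : fus_idx -> fus_ring;
  fus_basisP : forall x : fus_ring, exists! c : {ffun fus_idx -> int},
    x = \sum_i fus_basis i *~ c i;
  fus_one : fus_idx;
  fus_oneE : fus_basis fus_one = 1;
  fus_coef : fus_idx -> fus_idx -> fus_idx -> nat;
  fus_mulE : forall j k, fus_basis j * fus_basis k =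
    \sum_l fus_basis l *+ fus_coef j k l;
  fus_dual : fus_idx -> fus_idx;
  fus_dualK : involutive fus_dual;
  fus_star : {additive fus_ring -> fus_ring};
  fus_starE : forall i, fus_star (fus_basis i) = fus_basis (fus_dual i);
  fus_starK : involutive fus_star;
  fus_starM : forall x y, fus_star (x * y) = fus_star y * fus_star x;
  fus_coef1 : forall j k, fus_coef j k fus_one = (k == fus_dual j)
}.

Definition fus_rank (R : fusion_ring) : nat := #|fus_idx R|.

Definition fusion_isomorphic (R S : fusion_ring) : Prop :=
  exists (f : {rmorphism R -> S}) (s : fus_idx R -> fus_idx S),
    [/\ bijective f, bijective s &
        forall i, f (fus_basis i) = fus_basis (s i)].

(* A representation of the scalar extension of R to C, on column vectors of
   height m, is given by a unital ring morphism phi : R -> 'M[C]_m. The rows of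
   U span the transposes of a space of column vectors; this space is stable
   under the action of x when U is stable under right multiplication by
   (phi x)^T. *)
Definition irreducible_rep (C : fieldType) (R : fusion_ring) (m : nat)
    (phi : {rmorphism R -> 'M[C]_m}) : Prop :=
  (0 < m)%N /\
  forall U : 'M[C]_m, (forall x : R, stablemx U (phi x)^T) ->
    U = 0 \/ row_full U.

Definition formal_codegree_of (C : fieldType) (R : fusion_ring) (m : nat)
    (phi : {rmorphism R -> 'M[C]_m}) (f : C) : Prop :=
  \sum_i \tr (phi (fus_basis i)) *: phi (fus_basis (fus_dual i)) = f%:M.

Definition is_formal_codegree (C : fieldType) (R : fusion_ring) (f : C) :
    Prop :=
  exists (m : nat) (phi : {rmorphism R -> 'M[C]_m}),
    irreducible_rep phi /\ formal_codegree_of phi f.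

(* sylvester_seq k is the list of the first k terms. *)
Fixpoint sylvester_seq (k : nat) : seq nat :=
  if k is k'.+1 then
    rcons (sylvester_seq k') (1 + \prod_(x <- sylvester_seq k') x)%N
  else [::].

Definition sylvester (k : nat) : nat :=
  (1 + \prod_(x <- sylvester_seq k) x)%N.

Lemma sylvester_seqE k :
  (\prod_(x <- sylvester_seq k) x = \prod_(i < k) sylvester i)%N.
Proof.
elim: k => [|k IH]; first by rewrite big_nil big_ord0.
by rewrite /= -cats1 big_cat big_seq1 big_ord_recr /= -IH.
Qed.

Lemma sylvester0 : sylvester 0 = 2%N.
Proof. by rewrite /sylvester sylvester_seqE big_ord0. Qed.

Lemma sylvesterS k : sylvester k.+1 = (1 + \prod_(i < k.+1) sylvester i)%N.
Proof. by rewrite /sylvester sylvester_seqE. Qed.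

Lemma sylvester_gt1 k : (1 < sylvester k)%N.
Proof.
case: k => [|k]; first by rewrite sylvester0.
rewrite sylvesterS add1n ltnS; apply: prodn_gt0 => i.
by rewrite /sylvester.
Qed.

(* The subtractions on nat are exact since every term is at least 2. *)
Definition greedy_dim (k : nat) : nat :=
  if k is k'.+1 then (sylvester k' - 1)%N else 1%N.

(* greedy_coef j k l is the coefficient of r_l in r_j * r_k. *)
Definition greedy_coef (j k l : nat) : nat :=
  if (j < k)%N then (if l == k then greedy_dim j else 0)%N
  else if (k < j)%N then (if l == j then greedy_dim k else 0)%N
  else if k is k'.+1 then
    (if l == k then sylvester k' - 2
     else if l < k then greedy_dim l else 0)%N
  else (l == 0%N).

Lemma greedy_dimSS k :
  greedy_dim k.+2 = (greedy_dim k.+1 + greedy_dim k.+1 ^ 2)%N.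
Proof.
rewrite /= sylvesterS add1n subn1 /= big_ord_recr /=.
have := sylvester_gt1 k.
have -> : (\prod_(i < k) sylvester i = sylvester k - 1)%N.
  by rewrite /sylvester sylvester_seqE add1n subn1.
case: (sylvester k) => // s _; rewrite subn1 /=; lia.
Qed.

Lemma sum_greedy_dim k :
  (\sum_(j < k.+1) greedy_dim j ^ 2 = greedy_dim k.+1)%N.
Proof.
elim: k => [|k IH]; first by rewrite big_ord1 /= sylvester0.
by rewrite big_ord_recr IH greedy_dimSS.
Qed.

Lemma greedy_coefC j k l : greedy_coef j k l = greedy_coef k j l.
Proof. by rewrite /greedy_coef; case: ltngtP => // ->. Qed.

Lemma sum_greedy_coef_lt (V : nmodType) n j k (F : nat -> V) :
  (j < k)%N -> (k <= n)%N ->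
  \sum_(l < n.+1) F l *+ greedy_coef j k l = F k *+ greedy_dim j.
Proof.
move=> jk kn; have kn1 : (k < n.+1)%N by [].
rewrite (bigD1 (Ordinal kn1)) //= big1 ?addr0.
  by rewrite /greedy_coef jk eqxx.
move=> l; rewrite -val_eqE /= => /negbTE lk.
by rewrite /greedy_coef jk lk.
Qed.

Lemma sum_greedy_coef_diag (V : nmodType) n k (F : nat -> V) : (k < n)%N ->
  \sum_(l < n.+1) F l *+ greedy_coef k.+1 k.+1 l =
    F k.+1 *+ (sylvester k - 2) + \sum_(j < k.+1) F j *+ greedy_dim j.
Proof.
move=> kn; rewrite -(big_mkord xpredT (fun l => F l *+ greedy_coef k.+1 k.+1 l)).
rewrite (@big_cat_nat _ _ _ k.+1) //=; last by lia.
rewrite (@big_ltn _ _ _ k.+1) //= addrCA; congr (_ + _).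
  by rewrite /greedy_coef ltnn eqxx.
rewrite [X in _ + X]big1_seq ?addr0.
  rewrite big_mkord; apply: eq_bigr => i _.
  by rewrite /greedy_coef ltnn (ltn_ord i) (ltn_eqF (ltn_ord i)).
move=> i /andP[_]; rewrite mem_index_iota => /andP[ki _].
by rewrite /greedy_coef ltnn (gtn_eqF ki) ltnNge (ltnW ki).
Qed.

Lemma sum_greedy_coef_00 (V : nmodType) n (F : nat -> V) :
  \sum_(l < n.+1) F l *+ greedy_coef 0 0 l = F 0.
Proof. by rewrite big_ord_recl /= big1 ?addr0 // => i _. Qed.

(* The row of the character table of the greedy ring indexed by m > 0; these
   characters are jointly injective, which gives associativity. *)
Definition greedy_chi (m k : nat) : int :=
  if (k < m)%N then (greedy_dim k)%:Z else if k == m then -1 else 0.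

Lemma greedy_chiM m n (j k : nat) : (0 < m)%N -> (j <= n)%N -> (k <= n)%N ->
  greedy_chi m j * greedy_chi m k =
    \sum_(l < n.+1) greedy_chi m l *+ greedy_coef j k l.
Proof.
move=> m0; wlog jk : j k / (j <= k)%N.
  move=> H jn kn; case/orP: (leq_total j k) => h; first exact: H.
  rewrite mulrC H //; apply: eq_bigr => l _; by rewrite greedy_coefC.
move=> jn kn; move: jk; rewrite leq_eqVlt => /predU1P[->|jk]; last first.
  rewrite sum_greedy_coef_lt // -mulr_natl natz /greedy_chi.
  case: (ltngtP k m) => km; last 2 first.
  - by rewrite !mulr0.
  - by rewrite -km jk.
  by rewrite (ltn_trans jk km).
case: k kn => [|k] kn.
  by rewrite sum_greedy_coef_00 /greedy_chi m0 /=.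
rewrite sum_greedy_coef_diag //.
have small i : (i <= m)%N ->
    \sum_(j0 < i) greedy_chi m j0 *+ greedy_dim j0 =
    (\sum_(j0 < i) greedy_dim j0 ^ 2)%N%:Z.
  move=> im; rewrite -natz natr_sum; apply: eq_bigr => l _.
  rewrite /greedy_chi (leq_trans (ltn_ord l) im).
  by rewrite -(natz (greedy_dim l)) -mulrnA mulnn.
have sk := sylvester_gt1 k.
have dk : greedy_dim k.+1 = (sylvester k - 1)%N by [].
case: (ltngtP k.+1 m) => km.
- rewrite small; last exact: ltnW.
  rewrite sum_greedy_dim /greedy_chi km -mulr_natl natz dk.
  case: (sylvester k) sk => [|[|s]] // _.
  rewrite !subSS !subn0; lia.
- have zero : \sum_(j0 < k.+1) greedy_chi m j0 *+ greedy_dim j0 = 0.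
    rewrite -(big_mkord xpredT (fun j0 => greedy_chi m j0 *+ greedy_dim j0)).
    rewrite (@big_cat_nat _ _ _ m) //=; last exact: ltnW.
    rewrite big_mkord small // (@big_ltn _ _ _ m) //= [X in _ + (_ + X)]big1_seq.
      rewrite addr0 /greedy_chi ltnn eqxx mulNrn natz.
      by case: m m0 {small km} => // m _; rewrite sum_greedy_dim subrr.
    move=> i /andP[_]; rewrite mem_index_iota => /andP[mi _].
    by rewrite /greedy_chi ltnNge (ltnW mi) (gtn_eqF mi) mul0rn.
  rewrite zero addr0 /greedy_chi ltnNge (ltnW km) (gtn_eqF km) mul0r.
  by rewrite mul0rn.
- rewrite small; last by rewrite km.
  rewrite sum_greedy_dim {1 2 3}/greedy_chi -km ltnn eqxx dk mulNrn natz.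
  case: (sylvester k) sk => [|[|s]] // _.
  rewrite !subSS !subn0; lia.
Qed.

Definition greedy_type (n : nat) : Type := 'rV[int]_n.+1.
HB.instance Definition _ n := GRing.Zmodule.on (greedy_type n).

Section GreedyRing.
Variable n : nat.
Local Notation T := (greedy_type n).

Definition greedy_vec (x : T) : 'rV[int]_n.+1 := x.
Definition greedy_basis (i : 'I_n.+1) : T := delta_mx 0 i : 'rV[int]_n.+1.
Definition greedy_mul (x y : T) : T :=
  \row_l \sum_j \sum_k greedy_vec x 0 j * greedy_vec y 0 k *+ greedy_coef j k l.

Definition greedy_ev (m : nat) (x : T) : int :=
  \sum_j greedy_vec x 0 j * greedy_chi m j.

Lemma greedy_evM m x y : (0 < m)%N ->
  greedy_ev m (greedy_mul x y) = greedy_ev m x * greedy_ev m y.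
Proof.
move=> m0; rewrite /greedy_ev big_distrlr /=.
under eq_bigr => l _.
  rewrite mxE mulr_suml; under eq_bigr => j _ do rewrite mulr_suml.
  over.
rewrite exchange_big /=; apply: eq_bigr => j _.
rewrite exchange_big /=; apply: eq_bigr => k _.
rewrite mulrACA (@greedy_chiM m n) // -1?ltnS // mulr_sumr.
by apply: eq_bigr => l _; rewrite mulrnAl mulrnAr.
Qed.

Lemma greedy_ev_inj x y :
  (forall m, (0 < m)%N -> greedy_ev m x = greedy_ev m y) -> x = y.
Proof.
move=> exy; pose c k : int :=
  if insub k is Some i then greedy_vec x 0 i - greedy_vec y 0 i else 0.
have cE (i : 'I_n.+1) : c i = greedy_vec x 0 i - greedy_vec y 0 i.
  by rewrite /c valK.
have c0 m : (0 < m)%N -> \sum_(j < n.+1) c j * greedy_chi m j = 0.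
  move=> m0; have /eqP := exy m m0.
  rewrite -subr_eq0 /greedy_ev -sumrB => /eqP e.
  by rewrite -[RHS]e; apply: eq_bigr => j _; rewrite cE mulrBl.
pose S m := \sum_(j < m) c j * (greedy_dim j)%:Z.
have SE m : (0 < m)%N -> (m <= n)%N -> c m = S m.
  move=> m0 mn; apply/eqP; rewrite eq_sym -subr_eq0 -[X in _ == X](c0 m m0).
  rewrite -(big_mkord xpredT (fun j => c j * greedy_chi m j)).
  rewrite (@big_cat_nat _ _ _ m) //=; last by lia.
  rewrite big_mkord (@big_ltn _ _ _ m) //= [X in _ + (_ + X)]big1_seq.
    rewrite addr0 {2}/greedy_chi ltnn eqxx mulrN1 /S.
    by apply/eqP; congr (_ - _); apply: eq_bigr => j _; rewrite /greedy_chi ltn_ord.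
  move=> i /andP[_]; rewrite mem_index_iota => /andP[mi _].
  by rewrite /greedy_chi ltnNge (ltnW mi) (gtn_eqF mi) mulr0.
have SS m : (0 < m)%N -> (m <= n)%N -> S m.+1 = S m * (1 + (greedy_dim m)%:Z).
  move=> m0 mn; rewrite /S big_ord_recr /= SE // -/(S m).
  by rewrite mulrDr mulr1.
have Sn : S n.+1 = 0.
  rewrite -[RHS](c0 n.+1) //; apply: eq_bigr => j _.
  by rewrite /greedy_chi ltn_ord.
have S0 m : (0 < m)%N -> (m <= n.+1)%N -> S m = 0.
  move=> m0 mn; rewrite -(subKn mn); have := leq_subr m n.+1.
  have : (n.+1 - m <= n)%N by lia.
  elim: (n.+1 - m)%N => [|i IH] in_ _; first by rewrite subn0.
  have /eqP := IH (ltnW in_) (leq_trans (ltnW in_) (leqnSn n)).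
  have -> : (n.+1 - i = (n.+1 - i.+1).+1)%N by lia.
  rewrite SS; [|lia|lia].
  rewrite mulf_eq0 => /orP[/eqP//|/eqP e].
  by exfalso; lia.
apply/rowP => i; apply/eqP; rewrite -subr_eq0 -/(greedy_vec x) -/(greedy_vec y).
rewrite -cE; case: (posnP i) => [i0|i0].
  rewrite i0; have := S0 1%N isT isT.
  by rewrite /S big_ord1 /= mulr1 => ->.
have i_n : (i <= n)%N by rewrite -ltnS.
by rewrite SE // S0 // leqW.
Qed.

Lemma greedy_vecD (x y : T) i :
  greedy_vec (x + y) 0 i = greedy_vec x 0 i + greedy_vec y 0 i.
Proof. by rewrite /greedy_vec mxE. Qed.

Lemma greedy_ev_basis m i : greedy_ev m (greedy_basis i) = greedy_chi m i.
Proof.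
rewrite /greedy_ev (bigD1 i) //= big1 ?addr0.
  by rewrite /greedy_vec mxE !eqxx mul1r.
by move=> j /negbTE ji; rewrite /greedy_vec mxE ji andbF mul0r.
Qed.

Lemma greedy_mulA : associative greedy_mul.
Proof. by move=> x y z; apply: greedy_ev_inj => m m0; rewrite !greedy_evM ?mulrA. Qed.

Lemma greedy_mulC : commutative greedy_mul.
Proof. by move=> x y; apply: greedy_ev_inj => m m0; rewrite !greedy_evM // mulrC. Qed.

Lemma greedy_mul1 : left_id (greedy_basis ord0) greedy_mul.
Proof.
move=> x; apply: greedy_ev_inj => m m0.
by rewrite greedy_evM // greedy_ev_basis /greedy_chi /= m0 mul1r.
Qed.

Lemma greedy_mulDl : left_distributive greedy_mul +%R.
Proof.
move=> x y z; apply/rowP => l; rewrite [in RHS]mxE !mxE -big_split /=.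
apply: eq_bigr => j _; rewrite -big_split /=; apply: eq_bigr => k _.
by rewrite greedy_vecD mulrDl mulrnDl.
Qed.

Lemma greedy_1neq0 : greedy_basis ord0 != 0.
Proof.
apply/eqP => /rowP/(_ 0); rewrite !mxE !eqxx //=.
Qed.

HB.instance Definition _ := GRing.Zmodule_isComNzRing.Build T
  greedy_mulA greedy_mulC greedy_mul1 greedy_mulDl greedy_1neq0.

Lemma greedy_sumE (F : 'I_n.+1 -> int) i :
  greedy_vec (\sum_j greedy_basis j *~ F j) 0 i = F i.
Proof.
have -> : \sum_j greedy_basis j *~ F j = (\row_j F j : 'rV[int]_n.+1) :> T.
  rewrite (row_sum_delta (\row_j F j)); apply: eq_bigr => j _.
  by rewrite mxE -(intz (F j)) scaler_int intz.
by rewrite /greedy_vec mxE.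
Qed.

Lemma greedy_basisP (x : T) : exists! c : {ffun 'I_n.+1 -> int},
  x = \sum_i greedy_basis i *~ c i.
Proof.
exists [ffun i => greedy_vec x 0 i]; split.
  apply/rowP => i; rewrite -/(greedy_vec x) -/(greedy_vec (\sum_i _)).
  by rewrite greedy_sumE ffunE.
by move=> c ->; apply/ffunP => i; rewrite ffunE greedy_sumE.
Qed.

Lemma greedy_mulE (j k : 'I_n.+1) : greedy_basis j * greedy_basis k =
  \sum_l greedy_basis l *+ greedy_coef j k l.
Proof.
apply/rowP => l; rewrite -/(greedy_vec (\sum_l _)).
rewrite (greedy_sumE (fun l => (greedy_coef j k l)%:Z)) mxE (bigD1 j) //=.
rewrite [X in _ + X]big1 ?addr0; last first.
  move=> i /negbTE ij; rewrite big1 // => h _.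
  by rewrite /greedy_vec !mxE ij andbF mul0r mul0rn.
rewrite (bigD1 k) //= big1 ?addr0.
  by rewrite /greedy_vec !mxE !eqxx /= mulr1 -[RHS]natz.
move=> i /negbTE ik.
by rewrite /greedy_vec !mxE ik andbF mulr0 mul0rn.
Qed.

Lemma greedy_coef1 (j k : 'I_n.+1) :
  greedy_coef j k (@ord0 n) = (k == j) :> nat.
Proof.
rewrite -val_eqE /= /greedy_coef.
case: ltngtP => jk; rewrite ?(gtn_eqF jk) ?(ltn_eqF jk).
- by rewrite ltn_eqF //; lia.
- by rewrite ltn_eqF //; lia.
by rewrite -jk; case: (nat_of_ord j).
Qed.

Definition greedy_ring : fusion_ring :=
  @FusionRing T 'I_n.+1 greedy_basis greedy_basisP ord0 erefl
    (fun j k l => greedy_coef j k l) greedy_mulE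
    id (fun=> erefl) idfun (fun=> erefl) (fun=> erefl) (@mulrC T) greedy_coef1.

Lemma greedy_mul_lt (j k : 'I_n.+1) : (j < k)%N ->
  greedy_basis j * greedy_basis k = greedy_basis k *+ greedy_dim j.
Proof.
move=> jk; rewrite greedy_mulE.
under eq_bigr => l _ do rewrite -[in greedy_basis l](inord_val l).
rewrite (sum_greedy_coef_lt (fun l => greedy_basis (inord l))) //.
  by rewrite inord_val.
by rewrite -ltnS.
Qed.

Lemma greedy_mul_diag (k : nat) : (k < n)%N ->
  greedy_basis (inord k.+1) * greedy_basis (inord k.+1) =
    greedy_basis (inord k.+1) *+ (sylvester k - 2) +
    \sum_(j < k.+1) greedy_basis (inord j) *+ greedy_dim j.
Proof.
move=> kn; rewrite greedy_mulE inordK //.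
under eq_bigr => l _ do rewrite -[in greedy_basis l](inord_val l).
exact: (sum_greedy_coef_diag (fun l => greedy_basis (inord l))).
Qed.

End GreedyRing.

(* Main.v *)
From HB Require Import structures.
Require Import Defs.
From mathcomp Require Import all_boot all_order all_algebra.
From mathcomp Require Import reals complex.
From mathcomp Require Import zify ring lra.
Local Open Scope ring_scope.
Import Order.TTheory GRing.Theory Num.Theory.
Set Implicit Arguments.
Unset Strict Implicit.
Unset Printing Implicit Defensive.

(** Only the direct implication has content: the characters [greedy_ev k.+1] of
    the greedy ring have codegrees [sylvester k] by a direct computation
    ([greedy_codegree]). Write [a_k] for [sylvester k], [N] for
    [greedy_dim n.+1], which is the product of the [a_k] for [k < n], and [d_j]
    for [greedy_dim j].

    Let [R] have rank [n.+1] and codegrees [a_0, ..., a_(n-1)]. Irreducible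
    representations with distinct codegrees are inequivalent, so by Schur
    orthogonality their matrix entries are linearly independent and the squares
    of their dimensions sum to at most [n.+1]; hence all [n] of them are
    characters [chi_k] ([linear_characters]). The orthogonal complement of the
    [chi_k] in the functionals on [R] is a line stable under [R], which gives one
    more character [psi]; as [\sum_k 1 / a_k = 1 - 1 / N], its codegree is [N]
    ([last_character]). The trace of [R] is then the sum of all characters
    divided by their codegrees.

    Suppose that [n > 1]. The integral central element [\sum_i b_i * b_i^*]
    takes distinct integral values, the codegrees, at the [n.+1] characters. This
    makes the characters integer-valued ([split_character_int]), and, since [N]
    is at least twice any other codegree, makes [psi] nonnegative on the basis
    ([dominant_character_ge0]). So the character table is an integral matrix with
    known row norms. Its first column is constant 1. If the columns
    [b_0, ..., b_k] agree with those of the greedy ring, their entries in the row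
    of [chi_k] are [d_0, ..., d_k], whose squares sum to [a_k - 1]; the row has
    norm [a_k], which leaves a single further entry, of square 1. Orthogonality
    with [psi] determines it, and the orthogonality relations of the columns
    determine the rest of its column ([column_determined]). Hence the whole table
    is greedy ([greedy_table]), and a fusion ring with the characters of the
    greedy ring is isomorphic to it ([fusion_isomorphic_of_table]). For [n = 1]
    the two codegrees coincide and a direct argument replaces the above
    ([greedy_of_codegree_two]). *)

(** * The trace and the Casimir tensor of a fusion ring *)

Section Trace.
Variable R : fusion_ring.
Local Notation b := (@fus_basis R).
Local Notation dual := (@fus_dual R).
Local Notation star := (@fus_star R).

Lemma fus_coord_ex (x : R) :
  exists c : {ffun fus_idx R -> int}, x == \sum_i b i *~ c i.
Proof. by have [c [xE _]] := fus_basisP x; exists c; apply/eqP. Qed.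

Definition fus_coord (x : R) : {ffun fus_idx R -> int} :=
  xchoose (fus_coord_ex x).

Lemma fus_coordE x : x = \sum_i b i *~ fus_coord x i.
Proof. exact/eqP/(xchooseP (fus_coord_ex x)). Qed.

Lemma fus_coord_uniq x c : x = \sum_i b i *~ c i -> fus_coord x =1 c.
Proof.
move=> xE i; have [c0 [_ c0u]] := fus_basisP x.
have <- := c0u _ (fus_coordE x); rewrite (c0u [ffun i => c i]) ?ffunE //.
by rewrite [LHS]xE; apply: eq_bigr => j _; rewrite ffunE.
Qed.

(** The symmetrizing trace of [R]: by [fus_tr_mul] the families [b_i] and
    [b_i^*] are dual bases for the form [(x, y) |-> fus_tr (x * y)]. *)
Definition fus_tr (x : R) : int := fus_coord x (fus_one R).

Fact fus_tr_is_zmod : zmod_morphism fus_tr.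
Proof.
move=> x y; rewrite /fus_tr.
rewrite (@fus_coord_uniq _ (fun i => fus_coord x i - fus_coord y i)) //.
rewrite {1}(fus_coordE x) {1}(fus_coordE y) -sumrB.
by apply: eq_bigr => i _; rewrite mulrzBr.
Qed.
HB.instance Definition _ := GRing.isZmodMorphism.Build R int fus_tr
  fus_tr_is_zmod.

Lemma fus_tr_mul i j : fus_tr (b i * b j) = (j == dual i)%:R.
Proof.
rewrite /fus_tr (@fus_coord_uniq _ (fun l => (fus_coef i j l)%:Z)).
  by rewrite fus_coef1 -natz.
by rewrite fus_mulE; apply: eq_bigr => l _.
Qed.

Lemma fus_coord_trr x i : fus_coord x i = fus_tr (x * b (dual i)).
Proof.
rewrite {2}(fus_coordE x) mulr_suml raddf_sum (bigD1 i) //= big1 ?addr0.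
  by rewrite mulrzAl raddfMz /= fus_tr_mul eqxx intz.
move=> j /negbTE ji; rewrite mulrzAl raddfMz /= fus_tr_mul.
by rewrite (inj_eq (inv_inj (@fus_dualK R))) eq_sym ji mul0rz.
Qed.

Lemma fus_coord_trl x i : fus_coord x i = fus_tr (b (dual i) * x).
Proof.
rewrite {2}(fus_coordE x) mulr_sumr raddf_sum (bigD1 i) //= big1 ?addr0.
  by rewrite mulrzAr raddfMz /= fus_tr_mul fus_dualK eqxx intz.
move=> j /negbTE ji.
by rewrite mulrzAr raddfMz /= fus_tr_mul fus_dualK ji mul0rz.
Qed.

Lemma fus_additiveE (V : zmodType) (f : {additive R -> V}) x :
  f x = \sum_i f (b i) *~ fus_coord x i.
Proof.
by rewrite {1}(fus_coordE x) raddf_sum; apply: eq_bigr => i _; rewrite raddfMz.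
Qed.

Lemma dual_inj : injective dual.
Proof. exact: inv_inj (@fus_dualK R). Qed.

Lemma reindex_dual (V : nmodType) (F : fus_idx R -> V) :
  \sum_i F i = \sum_i F (dual i).
Proof. by rewrite (reindex_inj dual_inj). Qed.

Lemma fus_tr1 : fus_tr 1 = 1.
Proof.
rewrite /fus_tr (@fus_coord_uniq _ (fun i => (i == fus_one R)%:R)) ?eqxx //.
rewrite (bigD1 (fus_one R)) //= eqxx fus_oneE big1 ?addr0 //.
by move=> i /negbTE ->.
Qed.

Lemma dual_one : dual (fus_one R) = fus_one R.
Proof.
have := fus_tr_mul (fus_one R) (fus_one R).
by rewrite !fus_oneE mulr1 fus_tr1; case: eqP.
Qed.

Lemma fus_tr_basis i : fus_tr (b i) = (i == fus_one R)%:R.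
Proof. by rewrite -[b i]mul1r -fus_oneE fus_tr_mul dual_one. Qed.

Lemma star_one : star 1 = 1.
Proof. by rewrite -fus_oneE fus_starE dual_one. Qed.

(** The tensor of dual bases [\sum_i b_i (x) b_i^*] is balanced: multiplying
    its left factor by [x] on the left is multiplying its right factor by [x] on
    the right. Both sides expand with the same coefficients
    [fus_tr (b_l^* * x * b_i)]. Schur orthogonality comes from this. *)
Lemma casimir_balanced (C : comNzRingType) (f g : {additive R -> C}) x :
  \sum_i f (x * b i) * g (b (dual i)) = \sum_i f (b i) * g (b (dual i) * x).
Proof.
under eq_bigr => i _ do rewrite fus_additiveE mulr_suml.
under [RHS]eq_bigr => i _ do
  rewrite [g _]fus_additiveE (reindex_dual (fun j => g (b j) *~ _)) mulr_sumr.
rewrite exchange_big /=; apply: eq_bigr => l _; apply: eq_bigr => i _.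
by rewrite mulrzAl mulrzAr fus_coord_trl fus_coord_trr fus_dualK mulrA.
Qed.

End Trace.

(** * Schur orthogonality *)

Section Entry.
Variables (C : comNzRingType) (R : fusion_ring) (m : nat).
Variables (phi : {rmorphism R -> 'M[C]_m}) (p q : 'I_m).
Definition rep_entry (x : R) : C := phi x p q.
Fact rep_entry_is_zmod : zmod_morphism rep_entry.
Proof. by move=> x y; rewrite /rep_entry raddfB !mxE. Qed.
HB.instance Definition _ := GRing.isZmodMorphism.Build R C rep_entry
  rep_entry_is_zmod.
End Entry.

Lemma schur_rank (C : fieldType) (R : fusion_ring) m m'
    (phi : {rmorphism R -> 'M[C]_m}) (phi' : {rmorphism R -> 'M[C]_m'})
    (P : 'M_(m, m')) :
  irreducible_rep phi -> irreducible_rep phi' ->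
  (forall x, phi x *m P = P *m phi' x) -> P != 0 ->
  \rank P = m /\ \rank P = m'.
Proof.
move=> [_ irr] [_ irr'] PE P0.
have QE x : P^T *m (phi x)^T = (phi' x)^T *m P^T by rewrite -!trmx_mul PE.
split; rewrite -mxrank_tr.
- have [|/eqP|] := irr (genmx P^T).
  + move=> x; rewrite genmxE.
    apply: submx_trans (submxMr _ _) _; first by rewrite genmxE.
    by rewrite QE submxMl.
  + by rewrite -mxrank_eq0 genmxE mxrank_eq0 trmx_eq0 (negPf P0).
  + by rewrite /row_full genmxE => /eqP.
- have [|/eqP|] := irr' (kermx P^T).
  + move=> x; apply/sub_kermxP.
    by rewrite -mulmxA -QE mulmxA mulmx_ker mul0mx.
  + by rewrite kermx_eq0 /row_free => /eqP.
  + rewrite /row_full mxrank_ker => /eqP rk.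
    have : (0 < \rank P^T)%N by rewrite lt0n mxrank_eq0 trmx_eq0.
    by have := rank_leq_row P^T; lia.
Qed.

(** Schur's lemma makes an intertwiner [P != 0] invertible, so the two
    representations have equal traces and conjugate Casimir elements. *)
Lemma schur_codegree (C : fieldType) (R : fusion_ring) m m'
    (phi : {rmorphism R -> 'M[C]_m}) (phi' : {rmorphism R -> 'M[C]_m'})
    (P : 'M_(m, m')) f f' :
  irreducible_rep phi -> irreducible_rep phi' ->
  formal_codegree_of phi f -> formal_codegree_of phi' f' ->
  (forall x, phi x *m P = P *m phi' x) -> P != 0 -> f = f'.
Proof.
move=> irr irr' fE fE' PE P0.
have [r r'] := schur_rank irr irr' PE P0.
have mm' : m = m' by rewrite -r.
subst m'; have Pu : P \in unitmx by rewrite -row_full_unit /row_full r'.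
have trE x : \tr (phi x) = \tr (phi' x).
  by rewrite -[phi x](mulmxK Pu) PE mxtrace_mulC mulmxA mulVmx // mul1mx.
have : f%:M *m P = P *m f'%:M.
  rewrite -fE -fE' mulmx_suml mulmx_sumr; apply: eq_bigr => i _.
  by rewrite -scalemxAl -scalemxAr PE trE.
rewrite mul_scalar_mx mul_mx_scalar => /eqP; rewrite -subr_eq0 -scalerBl.
by rewrite scaler_eq0 (negPf P0) orbF subr_eq0 => /eqP.
Qed.

Lemma schur_scalar (C : closedFieldType) (R : fusion_ring) m
    (phi : {rmorphism R -> 'M[C]_m}) (P : 'M_m) :
  irreducible_rep phi -> (forall x, phi x *m P = P *m phi x) ->
  exists a, P = a%:M.
Proof.
move=> irr PE; have [m0 _] := irr.
have [a] : exists a, root (char_poly P) a.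
  by apply/closed_rootP; rewrite size_char_poly; lia.
rewrite -eigenvalue_root_char => /eigenvalueP[v vE v0].
exists a; apply/eqP; rewrite -subr_eq0; apply/negPn/negP => Pa0.
have [x|r _] := schur_rank irr irr _ Pa0.
  by rewrite mulmxBl mulmxBr PE scalar_mxC.
have fr : row_free (P - a%:M) by rewrite /row_free r.
have : v *m (P - a%:M) == 0 by rewrite mulmxBr vE mul_mx_scalar subrr.
by rewrite mulmx_free_eq0 // (negPf v0).
Qed.

Section EntryOrthogonality.
Variables (C : closedFieldType) (R : fusion_ring).
Local Notation b := (@fus_basis R).
Local Notation dual := (@fus_dual R).

(** The average [\sum_i phi b_i * E_(q,r) * phi' b_i^*] of the matrix unit
    [E_(q,r)], written entrywise. *)
Definition entry_pairing m m' (phi : {rmorphism R -> 'M[C]_m})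
    (phi' : {rmorphism R -> 'M[C]_m'}) (q : 'I_m) (r : 'I_m') : 'M[C]_(m, m') :=
  \matrix_(p, s) \sum_i phi (b i) p q * phi' (b (dual i)) r s.

Lemma entry_pairing_intertwines m m' (phi : {rmorphism R -> 'M[C]_m})
    (phi' : {rmorphism R -> 'M[C]_m'}) q r x :
  phi x *m entry_pairing phi phi' q r = entry_pairing phi phi' q r *m phi' x.
Proof.
apply/matrixP => p s; rewrite !mxE.
have := casimir_balanced (rep_entry phi p q) (rep_entry phi' r s) x.
rewrite /= /rep_entry => e.
transitivity (\sum_i phi (x * b i) p q * phi' (b (dual i)) r s).
  under eq_bigr => t _ do rewrite mxE mulr_sumr.
  rewrite exchange_big; apply: eq_bigr => i _ /=.
  rewrite rmorphM /= [in RHS]mxE mulr_suml; apply: eq_bigr => t _.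
  by rewrite mulrA.
rewrite e; under [RHS]eq_bigr => t _ do rewrite mxE mulr_suml.
rewrite [RHS]exchange_big; apply: eq_bigr => i _ /=.
rewrite rmorphM /= [in LHS]mxE mulr_sumr; apply: eq_bigr => t _.
by rewrite mulrA.
Qed.

Lemma entry_orthogonal m m' (phi : {rmorphism R -> 'M[C]_m})
    (phi' : {rmorphism R -> 'M[C]_m'}) f f' p q r s :
  irreducible_rep phi -> irreducible_rep phi' ->
  formal_codegree_of phi f -> formal_codegree_of phi' f' -> f != f' ->
  \sum_i phi (b i) p q * phi' (b (dual i)) r s = 0.
Proof.
move=> irr irr' fE fE' ff'.
suff /matrixP/(_ p s) : entry_pairing phi phi' q r = 0 by rewrite !mxE.
apply/eqP/negPn/negP => P0; case/negP: ff'; apply/eqP.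
exact: (schur_codegree irr irr' fE fE' (entry_pairing_intertwines _ _ _ _) P0).
Qed.

(** The average of a matrix unit is a scalar matrix by Schur's lemma; exchanging
    the two factors shows that the scalar vanishes off the diagonal and does not
    depend on the unit. Its value is read off the definition of the formal
    codegree. *)
Lemma entry_biorthogonal m (phi : {rmorphism R -> 'M[C]_m}) f p q r s :
  irreducible_rep phi -> formal_codegree_of phi f ->
  \sum_i phi (b i) p q * phi (b (dual i)) r s = f *+ ((p == s) && (q == r)).
Proof.
move=> irr fE; pose B p q r s := \sum_i phi (b i) p q * phi (b (dual i)) r s.
have BC p' q' r' s' : B p' q' r' s' = B r' s' p' q'.
  rewrite /B reindex_dual; apply: eq_bigr => i _.
  by rewrite fus_dualK mulrC.
have sc q' r' : exists a, forall p' s', B p' q' r' s' = a *+ (p' == s').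
  have [a aE] := schur_scalar irr (entry_pairing_intertwines phi phi q' r').
  by exists a => p' s'; move/matrixP/(_ p' s'): aE; rewrite !mxE.
have B0 p' q' r' s' : ~~ ((p' == s') && (q' == r')) -> B p' q' r' s' = 0.
  rewrite negb_and => /orP[/negbTE ne|/negbTE ne].
    by have [a ->] := sc q' r'; rewrite ne.
  by rewrite BC; have [a ->] := sc s' p'; rewrite eq_sym ne.
have Bdiag p' q' p2 q2 : B p' q' q' p' = B p2 q2 q2 p2.
  transitivity (B p2 q' q' p2).
    by have [a aE] := sc q' q'; rewrite !aE !eqxx.
  rewrite BC [RHS]BC.
  by have [a aE] := sc p2 p2; rewrite !aE !eqxx.
rewrite -/(B p q r s); case: (boolP (_ && _)) => [|/B0 -> //].
move=> /andP[/eqP <- /eqP <-]; rewrite mulr1n.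
have /matrixP/(_ p p) := fE; rewrite !mxE eqxx mulr1n => <-.
rewrite summxE /=; transitivity (\sum_t B t t p p).
  rewrite (bigD1 p) //= big1 ?addr0 //.
  move=> t tp; apply: B0; by rewrite (negPf tp).
rewrite /B exchange_big; apply: eq_bigr => i _.
by rewrite mxE mulr_suml.
Qed.

End EntryOrthogonality.

Lemma biorthogonal_card (F : fieldType) (I J : finType)
    (g h : J -> I -> F) (k : J -> F) :
  (forall j, k j != 0) ->
  (forall j j', \sum_i g j i * h j' i = k j *+ (j == j')) ->
  (#|J| <= #|I|)%N.
Proof.
move=> k0 gh.
pose A := \matrix_(p < #|J|, q < #|I|) g (enum_val p) (enum_val q).
pose B := \matrix_(q < #|I|, p < #|J|)
            (h (enum_val p) (enum_val q) / k (enum_val p)).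
apply: (@mulmx1_min F _ _ A B); apply/matrixP => p p'; rewrite !mxE.
transitivity (\sum_i g (enum_val p) i * h (enum_val p') i / k (enum_val p')).
  rewrite [RHS](reindex (enum_val : 'I_#|I| -> I)) /=; last first.
    by exists enum_rank => x _; rewrite ?enum_valK ?enum_rankK.
  by apply: eq_bigr => q _; rewrite !mxE mulrA.
rewrite -mulr_suml gh (inj_eq enum_val_inj).
by case: eqP => [->|_] /=; rewrite ?mulr1n ?mulfV ?mulr0n ?mul0r.
Qed.

(** If [y] had a nonzero coordinate [i0], then [y] together with the projection
    of the coordinate form at [i0] would enlarge the biorthogonal system beyond
    the dimension of the space. *)
Lemma biorthogonal_complete (F : fieldType) (I J : finType)
    (g h : J -> I -> F) (k : J -> F) (y : I -> F) :
  (forall j, k j != 0) ->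
  (forall j j', \sum_i g j i * h j' i = k j *+ (j == j')) ->
  #|J| = #|I| -> (forall j, \sum_i g j i * y i = 0) -> forall i, y i = 0.
Proof.
move=> k0 gh JI gy i0; apply/eqP/negPn/negP => y0.
pose g0 i : F := (i == i0)%:R - \sum_j h j i0 / k j * g j i.
have g0E (v : I -> F) : \sum_i g0 i * v i
    = v i0 - \sum_j h j i0 / k j * (\sum_i g j i * v i).
  under eq_bigr => i _ do rewrite mulrBl mulr_suml.
  rewrite sumrB exchange_big; congr (_ - _).
    rewrite (bigD1 i0) //= eqxx mul1r big1 ?addr0 // => i /negbTE ->.
    by rewrite mul0r.
  by apply: eq_bigr => j _; rewrite mulr_sumr; apply: eq_bigr => i _; rewrite mulrA.
pose g' (j : option J) := if j is Some j then g j else g0.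
pose h' (j : option J) := if j is Some j then h j else y.
pose k' (j : option J) := if j is Some j then k j else y i0.
suff : (#|{: option J}| <= #|I|)%N by rewrite card_option JI ltnn.
apply: (@biorthogonal_card F I _ g' h' k'); first by case.
case=> [j|] [j'|] /=; rewrite ?gh ?gy ?g0E //.
- rewrite (bigD1 j') //= gh eqxx mulr1n divfK // big1 ?addr0 ?subrr //.
  by move=> j /negbTE jj'; rewrite gh jj' mulr0.
- by rewrite big1 ?subr0 // => j _; rewrite gy mulr0.
Qed.

(** * Irreducible representations in number close to the rank *)

Lemma sum_dim_sq_le_rank (C : closedFieldType) (R : fusion_ring) (n : nat)
    (m : 'I_n -> nat) (phi : forall k, {rmorphism R -> 'M[C]_(m k)})
    (f : 'I_n -> C) :
  injective f -> (forall k, f k != 0) ->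
  (forall k, irreducible_rep (phi k)) ->
  (forall k, formal_codegree_of (phi k) (f k)) ->
  (\sum_k m k * m k <= fus_rank R)%N.
Proof.
move=> finj f0 irr fE.
pose J := {k : 'I_n & 'I_(m k) * 'I_(m k)}%type.
have cJ : #|{: J}| = (\sum_k m k * m k)%N.
  rewrite card_tagged sumnE big_map big_enum /=; apply: eq_bigr => k _.
  by rewrite card_prod card_ord.
rewrite -cJ.
pose g (j : J) i := phi (tag j) (fus_basis i) (tagged j).1 (tagged j).2.
pose h (j : J) i :=
  phi (tag j) (fus_basis (fus_dual i)) (tagged j).2 (tagged j).1.
apply: (@biorthogonal_card C _ _ g h (fun j => f (tag j))) => // -[k [p q]] [l [r s]].
rewrite /g /h /=; have [kl|kl] := eqVneq k l; last first.
  rewrite (entry_orthogonal _ _ _ _ (irr k) (irr l) (fE k) (fE l)); last first.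
    by rewrite (inj_eq finj).
  by case: eqP => // e; case/eqP: kl; exact: (congr1 (@tag _ _) e).
subst l; rewrite (entry_biorthogonal _ _ _ _ (irr k) (fE k)).
by rewrite eq_Tagged /= xpair_eqE.
Qed.

(** With [n] inequivalent irreducible representations and rank [n.+1], a single
    dimension at least 2 would already make the sum of squares at least
    [n - 1 + 4]. *)
Lemma linear_characters (C : closedFieldType) (R : fusion_ring) (n : nat)
    (f : 'I_n -> C) :
  injective f -> (forall k, f k != 0) ->
  (forall k, is_formal_codegree R (f k)) -> fus_rank R = n.+1 ->
  exists chi : 'I_n -> {rmorphism R -> C}, forall k,
    \sum_i chi k (fus_basis i) * chi k (fus_basis (fus_dual i)) = f k.
Proof.
move=> finj f0 fP rk; have [m mP] := fin_all_exists fP.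
have [phi phiP] := fin_all_exists mP.
have irr k := (phiP k).1; have fE k := (phiP k).2.
have sq := sum_dim_sq_le_rank finj f0 irr fE; rewrite rk in sq.
have m1 k : m k = 1%N.
  have pos l : (0 < m l)%N by have [] := irr l.
  rewrite (bigD1 k) //= in sq.
  have : (\sum_(l < n | l != k) 1 <= \sum_(l < n | l != k) m l * m l)%N.
    by apply: leq_sum => l _; rewrite muln_gt0 pos.
  rewrite sum1_card cardC1 card_ord.
  move=> le; have := leq_trans (leq_add (leqnn (m k * m k)) le) sq.
  have := pos k; have := ltn_ord k.
  by case: (m k) => [|[|mk]] //; rewrite mulSn; lia.
apply: (@fin_all_exists _ (fun=> {rmorphism R -> C})
  (fun k c => \sum_i c (fus_basis i) * c (fus_basis (fus_dual i)) = f k)) => k.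
move: (phi k) (fE k) => {phi phiP irr fE}; rewrite m1 => phi.
rewrite /formal_codegree_of => /matrixP/(_ 0 0).
have trE x : \tr (phi x) = phi x 0 0 by rewrite /mxtrace big_ord1.
rewrite summxE mxE eqxx mulr1n => <-.
have mon : monoid_morphism (rep_entry phi 0 0).
  split; first by rewrite /rep_entry rmorph1 mxE eqxx.
  by move=> x y; rewrite /rep_entry rmorphM !mxE big_ord1.
pose c : {rmorphism R -> C} := HB.pack (rep_entry phi 0 0)
  (GRing.isZmodMorphism.Build _ _ _ (@rep_entry_is_zmod C R 1 phi 0 0))
  (GRing.isMonoidMorphism.Build _ _ _ mon).
by exists c; apply: eq_bigr => i _; rewrite mxE trE.
Qed.

(** * Orthogonality of characters and the last character *)

Section Pairing.
Variables (C : comNzRingType) (R : fusion_ring).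

Definition fus_pairing (f g : R -> C) : C :=
  \sum_i f (fus_basis i) * g (fus_basis (fus_dual i)).

Lemma fus_pairingC f g : fus_pairing f g = fus_pairing g f.
Proof.
rewrite /fus_pairing reindex_dual; apply: eq_bigr => i _.
by rewrite fus_dualK mulrC.
Qed.

Lemma fus_pairing_tr (f : R -> C) :
  fus_pairing (fun x => (fus_tr x)%:~R) f = f 1.
Proof.
rewrite /fus_pairing (bigD1 (fus_one R)) //= big1 ?addr0.
  by rewrite fus_tr_basis eqxx dual_one fus_oneE mul1r.
by move=> i /negbTE ne; rewrite fus_tr_basis ne mul0r.
Qed.

End Pairing.

Lemma character_orthogonal (C : idomainType) (R : fusion_ring)
    (chi chi' : {rmorphism R -> C}) :
  fus_pairing chi chi' != 0 -> chi =1 chi'.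
Proof.
move=> P0 x; apply: (mulIf P0); rewrite /fus_pairing !mulr_sumr.
have := casimir_balanced chi chi' x; rewrite /= => e.
under eq_bigr => i _ do rewrite mulrA -rmorphM.
rewrite e; apply: eq_bigr => i _.
by rewrite rmorphM /= [chi' _ * chi' _]mulrC mulrCA.
Qed.

Lemma codegree_orthogonal (C : idomainType) (R : fusion_ring)
    (chi chi' : {rmorphism R -> C}) :
  fus_pairing chi chi != fus_pairing chi' chi' -> fus_pairing chi chi' = 0.
Proof.
apply: contraNeq => /character_orthogonal e; apply/eqP.
by apply: eq_bigr => i _; rewrite !e.
Qed.

(** [x |-> (chi x^* )^*] is again a character, and its pairing with [chi] is
    [\sum_i |chi b_i|^2 > 0], so it is [chi]. *)
Lemma character_star (C : numClosedFieldType) (R : fusion_ring)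
    (chi : {rmorphism R -> C}) x :
  chi (fus_star R x) = (chi x)^*.
Proof.
pose c y := (chi (fus_star R y))^*.
have zc : zmod_morphism c by move=> y z; rewrite /c !raddfB.
have mc : monoid_morphism c.
  split; first by rewrite /c star_one !rmorph1.
  by move=> y z; rewrite /c fus_starM !rmorphM mulrC.
pose chi' : {rmorphism R -> C} := HB.pack c
  (GRing.isZmodMorphism.Build _ _ _ zc) (GRing.isMonoidMorphism.Build _ _ _ mc).
have e : chi =1 chi'.
  apply: character_orthogonal; rewrite /fus_pairing.
  rewrite (bigD1 (fus_one R)) //= gt_eqF // addrC ltr_wpDl //.
    apply: sumr_ge0 => i _; rewrite /c fus_starE fus_dualK; exact: mul_conjC_ge0.
  by rewrite /c dual_one fus_oneE star_one !rmorph1 mulr1.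
by rewrite [chi x]e /= /c conjCK.
Qed.

Section LastCharacter.
Variables (C : fieldType) (R : fusion_ring) (n : nat).
Variables (chi : 'I_n -> {rmorphism R -> C}) (a : 'I_n -> C) (N : C).
Hypothesis rankR : fus_rank R = n.+1.
Hypothesis a_inj : injective a.
Hypothesis a_neq0 : forall k, a k != 0.
Hypothesis N_neq0 : N != 0.
Hypothesis sum_inv : \sum_k (a k)^-1 = 1 - N^-1.
Hypothesis chiE : forall k, fus_pairing (chi k) (chi k) = a k.

(** The trace is the sum of all characters divided by their codegrees; removing
    the known ones leaves the missing character divided by [N]. *)
Definition residual (x : R) : C := (fus_tr x)%:~R - \sum_k chi k x / a k.

Fact residual_is_zmod : zmod_morphism residual.
Proof.
move=> x y; rewrite /residual raddfB rmorphB /=.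
under eq_bigr => k _ do rewrite raddfB mulrBl.
by rewrite sumrB; ring.
Qed.
HB.instance Definition _ := GRing.isZmodMorphism.Build R C residual
  residual_is_zmod.

Lemma chi_orth k l : fus_pairing (chi k) (chi l) = a k *+ (k == l).
Proof.
have [->|ne] := eqVneq k l; first by rewrite chiE.
by rewrite codegree_orthogonal // !chiE (inj_eq a_inj).
Qed.

Lemma residual1 : residual 1 = N^-1.
Proof.
rewrite /residual fus_tr1; under eq_bigr => k _ do rewrite rmorph1 mul1r.
by rewrite sum_inv; ring.
Qed.

Lemma residual_pairing (f : R -> C) :
  fus_pairing residual f = f 1 - \sum_k fus_pairing (chi k) f / a k.
Proof.
rewrite -(fus_pairing_tr f) /fus_pairing /residual.
under eq_bigr => i _ do rewrite mulrBl mulr_suml.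
rewrite sumrB exchange_big; congr (_ - _); apply: eq_bigr => k _.
by rewrite mulr_suml; apply: eq_bigr => i _; rewrite mulrAC.
Qed.

Lemma residual_orth k : fus_pairing residual (chi k) = 0.
Proof.
rewrite residual_pairing rmorph1 (bigD1 k) //= big1 ?addr0.
  by rewrite chiE mulfV ?subrr.
by move=> l ne; rewrite chi_orth (negPf ne) mul0r.
Qed.

Lemma residual_norm : fus_pairing residual residual = N^-1.
Proof.
rewrite residual_pairing residual1 big1 ?subr0 // => k _.
by rewrite fus_pairingC residual_orth mul0r.
Qed.

(** The [chi k] and [residual] form an orthogonal basis of the functionals, so
    the functionals orthogonal to every [chi k] are the multiples of
    [residual]. *)
Lemma residual_unique (f : R -> C) : (forall k, fus_pairing (chi k) f = 0) ->
  forall i, f (fus_basis i) = N * f 1 * residual (fus_basis i).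
Proof.
move=> chif i; apply/eqP; rewrite -subr_eq0 -(fus_dualK i); apply/eqP.
pose g (j : option 'I_n) i :=
  if j is Some k then chi k (fus_basis i) else residual (fus_basis i).
pose h (j : option 'I_n) i := g j (fus_dual i).
pose y i := f (fus_basis (fus_dual i)) - N * f 1 * residual (fus_basis (fus_dual i)).
rewrite -/(y _).
apply: (@biorthogonal_complete C _ _ g h (fun j => if j is Some k then a k else N^-1)).
- by case=> [k|]; rewrite ?invr_neq0.
- case=> [k|] [l|]; rewrite /h /g.
  + exact: chi_orth.
  + exact: etrans (fus_pairingC _ _) (residual_orth k).
  + exact: residual_orth.
  + exact: residual_norm.
- by rewrite card_option card_ord; exact: esym rankR.
- have yE F : \sum_i F (fus_basis i) * y i
      = fus_pairing F f - N * f 1 * fus_pairing F residual.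
    rewrite /fus_pairing mulr_sumr -sumrB; apply: eq_bigr => j _.
    by rewrite /y; ring.
  case=> [k|]; rewrite /g yE.
    by rewrite chif fus_pairingC residual_orth mulr0 subr0.
  rewrite residual_norm residual_pairing big1 ?subr0; last first.
    by move=> k _; rewrite chif mul0r.
  by rewrite mulrAC mulfV // mul1r subrr.
Qed.

(** The functional [z |-> residual (z * y)] stays orthogonal to every [chi k]
    because [chi k] is multiplicative, hence is a multiple of [residual]. *)
Lemma residualM x y : residual (x * y) = N * residual x * residual y.
Proof.
have e k : fus_pairing (chi k) (fun z => residual (z * y)) = 0.
  apply: etrans (esym (casimir_balanced (chi k) residual y)) _ => /=.
  under eq_bigr => i _ do rewrite rmorphM -mulrA.
  rewrite -mulr_sumr; have := residual_orth k; rewrite fus_pairingC /fus_pairing.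
  by move=> ->; rewrite mulr0.
have {}e := residual_unique e.
rewrite [x in LHS](fus_coordE x) [residual x in RHS]fus_additiveE.
rewrite mulr_suml raddf_sum mulr_sumr mulr_suml; apply: eq_bigr => i _ /=.
rewrite mulrzAl raddfMz /= e mul1r mulrzAr mulrzAl; congr (_ *~ _).
by rewrite mulrAC.
Qed.

Lemma last_character : exists psi : {rmorphism R -> C},
  [/\ forall x, (fus_tr x)%:~R = psi x / N + \sum_k chi k x / a k,
      forall k, fus_pairing (chi k) psi = 0 & fus_pairing psi psi = N].
Proof.
pose p x := N * residual x.
have zp : zmod_morphism p by move=> x y; rewrite /p raddfB mulrBr.
have mp : monoid_morphism p.
  split; first by rewrite /p residual1 mulfV.
  by move=> x y; rewrite /p residualM; ring.
pose psi : {rmorphism R -> C} := HB.pack p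
  (GRing.isZmodMorphism.Build _ _ _ zp) (GRing.isMonoidMorphism.Build _ _ _ mp).
exists psi; split=> [x|k|] /=.
- by rewrite /p mulrAC mulfV // mul1r /residual subrK.
- rewrite -[RHS](mulr0 N) -(residual_orth k) fus_pairingC /fus_pairing mulr_sumr.
  by apply: eq_bigr => i _; rewrite /p mulrA.
- have : N * N * fus_pairing residual residual = N by rewrite residual_norm mulfK.
  move=> e; rewrite -[RHS]e /fus_pairing mulr_sumr; apply: eq_bigr => i _.
  by rewrite /p; ring.
Qed.
End LastCharacter.

(** * Integrality and positivity of characters *)

(** Euclidean descent on one coordinate [i0] of the integral eigenvector [x]: the
    eigenvector [y * x - q * x] has as [i0]-th coordinate the remainder of
    [(y * x)_i0] modulo [x_i0]. When it vanishes, [c] is the quotient [q]. *)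
Lemma eigenvalue_int (C : numFieldType) (R : fusion_ring) (c : C) (y x : R) :
  (forall i, (fus_coord (y * x) i)%:~R = c * (fus_coord x i)%:~R) -> x != 0 ->
  exists z : int, c = z%:~R.
Proof.
move=> xE x0.
have [i0 xi0] : exists i0, fus_coord x i0 != 0.
  apply/existsP; apply: contraR x0 => /existsPn x0.
  rewrite (fus_coordE x) big1 // => i _.
  by have /negPn/eqP-> := x0 i; rewrite mulr0z.
have [s] := ubnP `|fus_coord x i0|%N; elim: s => // s IH in x xE xi0 {x0} *.
rewrite ltnS => xs.
have coordB u v i : fus_coord (u - v) i = fus_coord u i - fus_coord v i.
  by rewrite !fus_coord_trl mulrBr raddfB.
have coordZ u q i : fus_coord (u *~ q) i = fus_coord u i * q.
  by rewrite !fus_coord_trl mulrzAr raddfMz /= -mulrzz.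
pose q := (fus_coord (y * x) i0 %/ fus_coord x i0)%Z.
pose r := (fus_coord (y * x) i0 %% fus_coord x i0)%Z.
have qr : fus_coord (y * x) i0 = q * fus_coord x i0 + r by exact: divz_eq.
have [r0|r0] := eqVneq r 0.
  exists q; apply: (@mulIf _ (fus_coord x i0)%:~R); first by rewrite intr_eq0.
  by rewrite -xE qr r0 addr0 rmorphM.
apply: (IH (y * x - x *~ q)).
- have yv v i : fus_coord (y * v) i
      = \sum_l fus_coord (y * fus_basis l) i * fus_coord v l.
    rewrite {1}(fus_coordE v) mulr_sumr fus_coord_trl mulr_sumr raddf_sum.
    by apply: eq_bigr => l _; rewrite /= -fus_coord_trl mulrzAr coordZ.
  move=> i; rewrite mulrBr mulrzAr !coordB !coordZ !rmorphB !rmorphM /= xE.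
  rewrite mulrBr [c * (_ * q%:~R)]mulrA; congr (_ - _).
  rewrite -xE !yv !rmorph_sum mulr_sumr.
  by apply: eq_bigr => l _; rewrite !rmorphM /= xE mulrCA.
- by rewrite coordB coordZ qr mulrC addrAC subrr add0r.
- rewrite coordB coordZ qr [_ * q]mulrC addrAC subrr add0r.
  have := ltz_mod (fus_coord (y * x) i0) xi0; rewrite -/r.
  have := modz_ge0 (fus_coord (y * x) i0) xi0; rewrite -/r.
  lia.
Qed.

Section SplitTable.
Variables (C : numFieldType) (R : fusion_ring) (J : finType).
Variables (X : J -> {rmorphism R -> C}) (f : J -> int).
Hypothesis codegX : forall j, fus_pairing (X j) (X j) = (f j)%:~R.
Hypothesis trX : forall x, (fus_tr x)%:~R = \sum_j X j x / (f j)%:~R.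

Definition casimir : R := \sum_i fus_basis i * fus_basis (fus_dual i).

Lemma char_casimir j : X j casimir = (f j)%:~R.
Proof. by rewrite -codegX rmorph_sum; apply: eq_bigr => i _; rewrite rmorphM. Qed.

(** When the codegrees are distinct, the product [w] of the
    [casimir - f l] for [l != j] is killed by every character but [X j]; it is
    thus an integral eigenvector of the multiplication by [y], with eigenvalue
    [X j y]. *)
Lemma split_character_int j y : injective f -> exists z : int, X j y = z%:~R.
Proof.
move=> f_inj; pose w := \prod_(l | l != j) (casimir - (f l)%:~R).
have Xw l : X l w = \prod_(l' | l' != j) (f l - f l')%:~R.
  rewrite rmorph_prod; apply: eq_bigr => l' _.
  by rewrite rmorphB /= char_casimir rmorph_int rmorphB.
have Xw0 l : l != j -> X l w = 0.
  by move=> lj; rewrite Xw (bigD1 l) //= subrr mul0r.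
apply: (@eigenvalue_int C R _ y w); last first.
  apply/eqP => w0; have /eqP := Xw j; rewrite w0 rmorph0 eq_sym.
  apply/negP/prodf_neq0 => l lj; rewrite intr_eq0 subr_eq0 eq_sym.
  by rewrite (inj_eq f_inj).
have XjE x : (fus_tr (x * w))%:~R = X j x * X j w / (f j)%:~R :> C.
  rewrite trX (bigD1 j) //= big1 ?addr0 ?rmorphM // => l lj.
  by rewrite rmorphM /= Xw0 // mulr0 mul0r.
by move=> i; rewrite !fus_coord_trl mulrA !XjE rmorphM /=; ring.
Qed.

Lemma fus_coord_mul_ge0 (x y : R) :
  (forall i, 0 <= fus_coord x i) -> (forall i, 0 <= fus_coord y i) ->
  forall i, 0 <= fus_coord (x * y) i.
Proof.
move=> x0 y0 i.
have -> : fus_coord (x * y) i = \sum_j \sum_k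
    (fus_coef j k i)%:Z * fus_coord y k * fus_coord x j.
  rewrite {1}(fus_coordE x) {1}(fus_coordE y) mulr_suml fus_coord_trl.
  rewrite mulr_sumr raddf_sum; apply: eq_bigr => j _ /=.
  rewrite !mulr_sumr raddf_sum; apply: eq_bigr => k _ /=.
  rewrite mulrzAl !mulrzAr !raddfMz /= -fus_coord_trl.
  rewrite (@fus_coord_uniq _ _ (fun l => (fus_coef j k l)%:Z)).
    by rewrite -!mulrzz.
  by rewrite fus_mulE.
by apply: sumr_ge0 => j _; apply: sumr_ge0 => k _; rewrite !mulr_ge0.
Qed.

Lemma fus_coord_basis (i l : fus_idx R) :
  fus_coord (fus_basis i) l = (l == i)%:R.
Proof. by rewrite fus_coord_trr fus_tr_mul (inj_eq (@dual_inj R)). Qed.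

(** Power iteration: [b_i * casimir ^+ m.+1] has nonnegative coordinates, and
    its trace [\sum_j x j * f j ^+ m] would be negative for large [m] if [x j0]
    were, since [f j0] dominates every other codegree. *)
Lemma dominant_character_ge0 (x : J -> int) (i : fus_idx R) (j0 : J) :
  (forall j, X j (fus_basis i) = (x j)%:~R) -> (forall j, 0 < f j) ->
  (forall j, j != j0 -> f j *+ 2 <= f j0) -> 0 <= x j0.
Proof.
move=> xE f_gt0 f2; rewrite leNgt; apply/negP => x_lt0.
have pos_basis k l : 0 <= fus_coord (@fus_basis R k) l.
  by rewrite fus_coord_basis ler0n.
have pos_cas l : 0 <= fus_coord casimir l.
  rewrite /casimir fus_coord_trl mulr_sumr raddf_sum; apply: sumr_ge0 => k _ /=.
  by rewrite -fus_coord_trl; apply: fus_coord_mul_ge0.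
have pos m l : 0 <= fus_coord (fus_basis i * casimir ^+ m) l.
  elim: m l => [|m IH] l; first by rewrite mulr1.
  by rewrite exprSr mulrA; apply: fus_coord_mul_ge0.
have key m : 0 <= \sum_j x j * f j ^+ m.
  have := pos m.+1 (fus_one R); rewrite -/(fus_tr _).
  rewrite -(ler_int C) trX => /le_trans p0; rewrite -(ler_int C); apply: p0.
  rewrite rmorph_sum le_eqVlt; apply/orP; left; apply/eqP.
  apply: eq_bigr => j _ /=.
  rewrite rmorphM rmorphXn /= xE char_casimir exprSr mulrA.
  rewrite mulfK ?intr_eq0 ?gt_eqF //.
  by rewrite rmorphM rmorphXn.
pose M := \sum_(j | j != j0) `|x j|.
have bound m : 2 ^+ m <= M.
  have fm : 0 < f j0 ^+ m by rewrite exprn_gt0.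
  rewrite -(ler_pM2r fm) mulr_suml.
  have := key m; rewrite (bigD1 j0) //= => k0.
  have {}k0 : f j0 ^+ m <= \sum_(j | j != j0) x j * f j ^+ m.
    have : (x j0 + 1) * f j0 ^+ m <= 0.
      apply: mulr_le0_ge0; last exact: ltW.
      by move: x_lt0; clear; lia.
    rewrite mulrDl mul1r; lra.
  have p2 : 0 <= 2 ^+ m :> int by rewrite exprn_ge0.
  apply: le_trans (ler_wpM2l p2 k0) _.
  rewrite mulr_sumr; apply: ler_sum => j jj0; rewrite mulrCA -exprMn.
  apply: le_trans (_ : `|x j| * (2 * f j) ^+ m <= _).
    by rewrite ler_wpM2r ?ler_norm // exprn_ge0 // mulr_ge0 // ltW.
  rewrite ler_wpM2l // lerXn2r ?nnegrE ?mulr_ge0 // ?(ltW (f_gt0 _)) //.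
  by rewrite mulr_natl f2.
have M0 : 0 <= M by rewrite sumr_ge0.
have := bound `|M|%N; rewrite -natrX natz -[X in _ <= X](gez0_abs M0) lez_nat.
by rewrite leqNgt ltn_expl.
Qed.

End SplitTable.

(** * Sylvester's sequence and the greedy character table *)

Lemma sylvester_greedy_dim k : sylvester k = (greedy_dim k.+1).+1.
Proof. by have := sylvester_gt1 k; rewrite /=; lia. Qed.

Lemma greedy_dim_gt0 k : (0 < greedy_dim k)%N.
Proof. by case: k => [|k] //; have := sylvester_gt1 k; rewrite /=; lia. Qed.

Lemma greedy_dimM k :
  (greedy_dim k.+2 = greedy_dim k.+1 * sylvester k)%N.
Proof. by rewrite greedy_dimSS sylvester_greedy_dim mulnS mulnn. Qed.

Lemma sylvester_lt k l : (k < l)%N -> (sylvester k < sylvester l)%N.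
Proof.
elim: l => // l IH; rewrite ltnS leq_eqVlt => kl.
have : (sylvester l < sylvester l.+1)%N.
  rewrite !sylvester_greedy_dim greedy_dimSS.
  have := greedy_dim_gt0 l.+1; nia.
by case/orP: kl => [/eqP->|/IH/ltn_trans]; last apply.
Qed.

Lemma greedy_dim_sylvester_le k n : (k < n)%N -> (1 < n)%N ->
  (sylvester k * 2 <= greedy_dim n.+1)%N.
Proof.
case: n => // n; rewrite !ltnS leq_eqVlt greedy_dimM => /predU1P[-> n0|kn _].
  rewrite mulnC leq_mul2r; apply/orP; right; have := sylvester_lt n0.
  by rewrite sylvester0 sylvester_greedy_dim; lia.
rewrite leq_mul ?sylvester_gt1 //; have := sylvester_lt kn.
by rewrite [sylvester n]sylvester_greedy_dim.
Qed.

Lemma sylvester_inj : injective sylvester.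
Proof.
move=> k l; case: (ltngtP k l) => // /sylvester_lt.
  by move=> /[swap] ->; rewrite ltnn.
by move=> /[swap] ->; rewrite ltnn.
Qed.

Local Arguments greedy_dim : simpl never.

Section Egyptian.
Variable F : numFieldType.

Lemma sylvester_neq0 k : (sylvester k)%:R != 0 :> F.
Proof. by rewrite pnatr_eq0; have := sylvester_gt1 k; lia. Qed.

Lemma greedy_dim_neq0 k : (greedy_dim k)%:R != 0 :> F.
Proof. by rewrite pnatr_eq0 -lt0n greedy_dim_gt0. Qed.

Lemma sylvester_natrE k :
  (sylvester k)%:R = (greedy_dim k.+1)%:R + 1 :> F.
Proof. by rewrite sylvester_greedy_dim -natr1. Qed.

Lemma sum_inv_sylvester n :
  \sum_(k < n) ((sylvester k)%:R : F)^-1 = 1 - ((greedy_dim n.+1)%:R)^-1.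
Proof.
elim: n => [|n IH]; first by rewrite big_ord0 /greedy_dim sylvester0 invr1 subrr.
rewrite big_ord_recr /= IH greedy_dimM natrM.
have := sylvester_neq0 n; have := greedy_dim_neq0 n.+1.
rewrite sylvester_natrE => u v; field.
by rewrite u v.
Qed.

Lemma greedy_column_sum n k : (k < n)%N ->
  \sum_(l < n) (greedy_chi l.+1 k.+1)%:~R / (sylvester l)%:R
    = - (greedy_dim k.+1)%:R / (greedy_dim n.+1)%:R :> F.
Proof.
elim: n => // n IH; rewrite ltnS leq_eqVlt => /predU1P[->|kn];
  rewrite big_ord_recr /=.
  rewrite big1 ?add0r; last first.
    move=> l _; have := ltn_ord l; rewrite /greedy_chi => ln.
    by rewrite ltnS ltnNge (ltnW ln) (gtn_eqF _) ?mul0r // ltnS.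
  rewrite /greedy_chi ltnn eqxx greedy_dimM natrM.
  have := sylvester_neq0 n; have := greedy_dim_neq0 n.+1.
  by move=> u v; field; rewrite u v.
rewrite IH // {1}/greedy_chi ltnS kn greedy_dimM natrM -pmulrn.
have := sylvester_neq0 n; have := greedy_dim_neq0 n.+1.
rewrite sylvester_natrE => u v; field.
by rewrite u v.
Qed.
End Egyptian.

Lemma sum_sqr_eq1 (I : finType) (P : pred I) (x : I -> int) :
  \sum_(i | P i) x i ^+ 2 = 1 ->
  exists i, [/\ P i, x i ^+ 2 = 1 & forall j, P j -> j != i -> x j = 0].
Proof.
move=> sx.
have [i /andP[Pi xi0]] : exists i, P i && (x i != 0).
  apply/existsP; apply: contra_eqT sx => /existsPn x0.
  rewrite big1 // => i Pi; have := x0 i.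
  by rewrite Pi negbK => /eqP->; rewrite expr0n.
have rest0 : 0 <= \sum_(j | P j && (j != i)) x j ^+ 2.
  by apply: sumr_ge0 => j _; apply: sqr_ge0.
have xi1 : 1 <= x i ^+ 2 by rewrite -gtz0_ge1 exprn_even_gt0.
rewrite (bigD1 i) //= in sx.
exists i; split=> //; first by lra.
move=> j Pj ji; apply/eqP; rewrite -sqrf_eq0; apply/eqP.
have /psumr_eq0P : \sum_(j | P j && (j != i)) x j ^+ 2 = 0 by lra.
by apply; rewrite ?Pj // => l _; apply: sqr_ge0.
Qed.

(** The ring enters from here on only through its character table, with rows
    [x k] and [y]: integrality, the sign of [y] and the orthogonality relations
    of rows and columns already force this table. *)
Section GreedyTable.
Variables (F : numFieldType) (n : nat) (I : finType) (i0 : I).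
Variables (x : 'I_n -> I -> int) (y : I -> int).
Hypothesis cardI : #|I| = n.+1.
Hypothesis x_one : forall k, x k i0 = 1.
Hypothesis y_one : y i0 = 1.
Hypothesis y_ge0 : forall i, 0 <= y i.
Hypothesis row_norm : forall k, \sum_i x k i ^+ 2 = sylvester k.
Hypothesis row_orth : forall k, \sum_i x k i * y i = 0.
Hypothesis col_orth : forall i, i != i0 ->
  \sum_k (x k i)%:~R / (sylvester k)%:R
    + (y i)%:~R / (greedy_dim n.+1)%:R = 0 :> F.
Hypothesis col_norm : forall i,
  \sum_k (x k i)%:~R ^+ 2 / (sylvester k)%:R
    + (y i)%:~R ^+ 2 / (greedy_dim n.+1)%:R = 1 :> F.

(** Write [e] for the column [k.+1] of the greedy table and [d] for the value of
    [y] in it. The relations for the column [i] give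
    [\sum_l (x l i - e l)^2 / sylvester l = 0]: the rows [0, ..., k] being
    known, the cross term [\sum_l x l i * e l / sylvester l] equals
    [d * \sum_l x l i / sylvester l + 1], and likewise for [\sum_l e l ^ 2 /
    sylvester l]. All terms are nonnegative, so the remaining rows agree. *)
Lemma column_determined (i : I) (k : 'I_n) : i != i0 ->
  (forall l : 'I_n, (l <= k)%N -> x l i = greedy_chi l.+1 k.+1) ->
  y i = greedy_dim k.+1 -> forall l, x l i = greedy_chi l.+1 k.+1.
Proof.
move=> ii0 xle yi; pose e (l : 'I_n) := greedy_chi l.+1 k.+1.
pose d : F := (greedy_dim k.+1)%:R; pose s l : F := (sylvester l)%:R.
pose N : F := (greedy_dim n.+1)%:R.
have yd : (y i)%:~R = d by rewrite yi.
have prod_e (z : 'I_n -> int) : (forall l : 'I_n, (l <= k)%N -> z l = e l) ->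
    \sum_l (z l)%:~R * (e l)%:~R / s l = d * (\sum_l (z l)%:~R / s l) + 1.
  move=> zle; rewrite mulr_sumr.
  (* Termwise, [z l * e l = d * z l + sylvester l * (l == k)]. *)
  have one : 1 = \sum_(l < n) (s l *+ (l == k)) / s l :> F.
    rewrite (bigD1 k) //= eqxx mulr1n mulfV ?sylvester_neq0 // big1 ?addr0 //.
    by move=> l /negbTE ->; rewrite mul0r.
  rewrite [X in _ + X]one -big_split /=; apply: eq_bigr => l _.
  rewrite mulrA -mulrDl; congr (_ / _).
  have [lk|kl|lk] := ltngtP l k.
  - rewrite zle ?(ltnW lk) // /e /greedy_chi ltnS ltnNge (ltnW lk) /=.
    by rewrite eqSS (gtn_eqF lk) -val_eqE /= (ltn_eqF lk) !mulr0 add0r.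
  - rewrite -val_eqE /= (gtn_eqF kl) mulr0n addr0 mulrC; congr (_ * _).
    by rewrite /e /greedy_chi ltnS kl -pmulrn.
  - have -> : l = k by apply: val_inj.
    rewrite zle // /e /greedy_chi ltnn !eqxx /s /d sylvester_natrE mulr1n.
    by ring.
have sum_e : \sum_l (e l)%:~R / s l = - d / N by apply: greedy_column_sum.
have sum_x : \sum_l (x l i)%:~R / s l = - d / N.
  by apply/eqP; rewrite mulNr -addr_eq0 -yd; apply/eqP/col_orth.
have ee := prod_e e (fun _ _ => erefl).
have xe := prod_e (x^~ i) xle.
have xx := col_norm i; rewrite yd -/N in xx.
have sq0 : \sum_l ((x l i)%:~R - (e l)%:~R) ^+ 2 / s l = 0.
  transitivity (\sum_l (x l i)%:~R ^+ 2 / s l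
    - 2 * (\sum_l (x l i)%:~R * (e l)%:~R / s l)
    + \sum_l (e l)%:~R * (e l)%:~R / s l).
    rewrite mulr_sumr -sumrB -big_split /=; apply: eq_bigr => l _; ring.
  rewrite ee xe sum_e sum_x.
  have -> : \sum_l (x l i)%:~R ^+ 2 / s l = 1 - d ^+ 2 / N.
    by rewrite -[in RHS]xx addrK.
  ring.
have s_gt0 l : 0 < s l by rewrite ltr0n ltnW ?sylvester_gt1.
have pos l : true -> 0 <= ((x l i)%:~R - (e l)%:~R) ^+ 2 / s l.
  by rewrite divr_ge0 ?(ltW (s_gt0 l)) // -rmorphB -rmorphXn ler0z sqr_ge0.
move=> l; have := psumr_eq0P pos sq0 (isT : xpredT l).
move/eqP; rewrite mulf_eq0 invr_eq0 (gt_eqF (s_gt0 l)) orbF sqrf_eq0 subr_eq0.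
rewrite eqr_int.
by move/eqP.
Qed.

(** Columns are found one at a time. Once the columns [0, ..., m] are found, their
    entries in the row [m] have squares summing to [sylvester m - 1], so exactly
    one other column [i] has a nonzero entry [+1] or [-1] there. Orthogonality of
    the row [m] with [y >= 0] makes it [-1], and gives [y i]; the rest of
    that column follows from [column_determined]. *)
Lemma greedy_table_prefix m : (m <= n)%N -> exists s : seq I,
  [/\ size s = m.+1, uniq s, nth i0 s 0 = i0,
      forall j, (j <= m)%N -> y (nth i0 s j) = greedy_dim j /\
        (forall l : 'I_n, x l (nth i0 s j) = greedy_chi l.+1 j) &
      forall (l : 'I_n) i, (l < m)%N -> i \notin s -> x l i = 0].
Proof.
elim: m => [_|m IH mn].
  by exists [:: i0]; split=> // -[|j] // _; split=> [|l]; rewrite /= ?x_one ?y_one.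
have [s [ss us s0 sP s_out]] := IH (ltnW mn); pose k := Ordinal mn.
have split_sum (G : I -> int) : \sum_i G i =
    \sum_(j < m.+1) G (nth i0 s j) + \sum_(i | i \notin s) G i.
  rewrite (bigID (mem s)) /= -big_uniq //=; congr (_ + _).
  by rewrite (big_nth i0) ss big_mkord.
have xk (j : 'I_m.+1) : x k (nth i0 s j) = greedy_dim j.
  have [_ ->] := sP _ (ltn_ord j : (j <= m)%N).
  by rewrite /greedy_chi ltn_ord.
have sqr_dim : \sum_(j < m.+1) (greedy_dim j : int) ^+ 2 = greedy_dim m.+1.
  rewrite -sum_greedy_dim -[RHS]natz natr_sum; apply: eq_bigr => j _.
  by rewrite natrX natz.
have [i [i_s xi2 x_out]] : exists i, [/\ i \notin s, x k i ^+ 2 = 1 &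
    forall j, j \notin s -> j != i -> x k j = 0].
  apply: sum_sqr_eq1; have := row_norm k; rewrite split_sum.
  under eq_bigr => j _ do rewrite xk.
  by rewrite sqr_dim sylvester_greedy_dim intS [1 + _]addrC => /addrI.
have [xi yi] : x k i = -1 /\ y i = greedy_dim m.+1.
  have := row_orth k; rewrite split_sum.
  under eq_bigr => j _.
    rewrite xk; have [-> _] := sP _ (ltn_ord j : (j <= m)%N).
    rewrite -expr2; over.
  rewrite sqr_dim (bigD1 i) //= big1 ?addr0; last first.
    by move=> j /andP[js ji]; rewrite x_out ?mul0r.
  have := y_ge0 i; have := greedy_dim_gt0 m.+1.
  move/eqP: xi2; rewrite sqrf_eq1 => /orP[] /eqP-> ; lia.
have i_i0 : i != i0.
  by apply: contraNneq i_s => ->; rewrite -[X in X \in _]s0 mem_nth ?ss.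
have xi_all : forall l : 'I_n, x l i = greedy_chi l.+1 m.+1.
  apply: (column_determined (k := k)) => // l; rewrite leq_eqVlt.
  case/predU1P => [lk|lk].
    have -> : l = k by apply: val_inj.
    by rewrite xi /greedy_chi ltnn eqxx.
  by rewrite s_out // /greedy_chi ltnS ltnNge (ltnW lk) /= gtn_eqF.
exists (rcons s i); split.
- by rewrite size_rcons ss.
- by rewrite rcons_uniq i_s.
- by rewrite nth_rcons ss.
- move=> j; rewrite nth_rcons ss leq_eqVlt => /predU1P[->|jm].
    by rewrite ltnn eqxx.
  by rewrite jm; apply: sP.
- move=> l j; rewrite ltnS leq_eqVlt mem_rcons inE negb_or => + /andP[ji js].
  case/predU1P => [lk|lm]; last exact: s_out.
  have -> : l = k by apply: val_inj.
  exact: x_out.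
Qed.

Lemma greedy_table : exists t : 'I_n.+1 -> I, bijective t /\
  forall j, y (t j) = greedy_dim j /\ (forall l, x l (t j) = greedy_chi l.+1 j).
Proof.
have [s [ss us s0 sP _]] := greedy_table_prefix (leqnn n).
exists (fun j => nth i0 s j); split; last by move=> j; exact: (sP j (ltn_ord j)).
apply: inj_card_bij; last by rewrite card_ord cardI.
move=> j j' /eqP; rewrite nth_uniq ?ss // => /eqP; exact: val_inj.
Qed.
End GreedyTable.

(** * Greedy rings and their codegrees *)

Section IsoOfTable.
Variables (C : numFieldType) (R : fusion_ring) (n : nat).
Variable t : 'I_n.+1 -> fus_idx R.
Hypothesis t_bij : bijective t.
Hypothesis table : forall m, (0 < m)%N -> exists X : {rmorphism R -> C},
  forall j, X (fus_basis (t j)) = (greedy_chi m j)%:~R.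

Definition to_greedy (x : R) : greedy_type n :=
  \sum_j greedy_basis j *~ fus_coord x (t j).

Lemma to_greedy_ev m (x : R) : (0 < m)%N -> exists X : {rmorphism R -> C},
  forall x, (greedy_ev m (to_greedy x))%:~R = X x.
Proof.
move=> m0; have [X XE] := table m0; exists X => z.
rewrite fus_additiveE (reindex t) /=; last exact: onW_bij.
rewrite /greedy_ev rmorph_sum; apply: eq_bigr => j _ /=.
by rewrite greedy_sumE rmorphM /= XE mulrzl.
Qed.

(** Multiplicativity is checked on characters: the evaluations [greedy_ev m] are
    jointly injective, and each of them composed with [to_greedy] is a character
    of [R]. *)
Lemma fusion_isomorphic_of_table : fusion_isomorphic R (greedy_ring n).
Proof.
have ev_inj (u v : greedy_type n) :
    (forall m, (0 < m)%N -> (greedy_ev m u)%:~R = (greedy_ev m v)%:~R :> C) ->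
    u = v.
  by move=> uv; apply: greedy_ev_inj => m /uv/intr_inj.
have zf : zmod_morphism to_greedy.
  move=> x y; rewrite /to_greedy -sumrB; apply: eq_bigr => j _.
  by rewrite !fus_coord_trl mulrBr raddfB mulrzBr.
have mf : monoid_morphism to_greedy.
  split=> [|x y]; apply: ev_inj => m m0; have [X XE] := to_greedy_ev 0 m0.
    by rewrite XE rmorph1 greedy_ev_basis /greedy_chi m0.
  by rewrite greedy_evM // rmorphM /= !XE rmorphM.
have fK x : \sum_j fus_basis (t j) *~ greedy_vec (to_greedy x) 0 j = x.
  rewrite [RHS](fus_coordE x) [RHS](reindex t) /=; last exact: onW_bij.
  by apply: eq_bigr => j _; rewrite greedy_sumE.
have gK y : to_greedy (\sum_j fus_basis (t j) *~ greedy_vec y 0 j) = y.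
  apply/rowP => j; rewrite -/(greedy_vec y) -/(greedy_vec (to_greedy _)).
  rewrite greedy_sumE; have [t' tK t'K] := t_bij.
  rewrite (@fus_coord_uniq _ _ (fun i => greedy_vec y 0 (t' i))) ?tK //.
  rewrite [RHS](reindex t) /=; last exact: onW_bij.
  by apply: eq_bigr => k _; rewrite tK.
pose f : {rmorphism R -> greedy_ring n} := HB.pack to_greedy
  (GRing.isZmodMorphism.Build R (greedy_ring n) to_greedy zf)
  (GRing.isMonoidMorphism.Build R (greedy_ring n) to_greedy mf).
have [t' tK t'K] := t_bij.
exists f, t'; split.
- by exists (fun y => \sum_j fus_basis (t j) *~ greedy_vec y 0 j).
- by exists t.
move=> i; rewrite /= /to_greedy (bigD1 (t' i)) //= big1 ?addr0.
  by rewrite fus_coord_basis t'K eqxx.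
move=> j ji; rewrite fus_coord_basis -{1}(t'K i) (inj_eq (can_inj tK)).
by rewrite (negPf ji).
Qed.
End IsoOfTable.

Lemma character_codegree (C : fieldType) (R : fusion_ring)
    (chi : {rmorphism R -> C}) : is_formal_codegree R (fus_pairing chi chi).
Proof.
pose phi x : 'M[C]_1 := (chi x)%:M.
have zp : zmod_morphism phi by move=> x y; rewrite /phi raddfB raddfB.
have mp : monoid_morphism phi.
  split; first by rewrite /phi rmorph1.
  by move=> x y; rewrite /phi rmorphM scalar_mxM.
pose phi' : {rmorphism R -> 'M[C]_1} := HB.pack phi
  (GRing.isZmodMorphism.Build _ _ _ zp) (GRing.isMonoidMorphism.Build _ _ _ mp).
exists 1%N, phi'; split.
  split=> // U _; have [->|U0] := eqVneq U 0; [by left | right].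
  by rewrite /row_full eqn_leq rank_leq_col lt0n mxrank_eq0.
rewrite /formal_codegree_of /fus_pairing raddf_sum; apply: eq_bigr => i _ /=.
by rewrite /phi mxtrace_scalar mulr1n scale_scalar_mx.
Qed.

Lemma sum_greedy_chi_sqr n k : (k < n)%N ->
  \sum_(j < n.+1) greedy_chi k.+1 j ^+ 2 = sylvester k.
Proof.
move=> kn; rewrite -(big_mkord xpredT (fun j => greedy_chi k.+1 j ^+ 2)).
rewrite (@big_cat_nat _ _ _ k.+1) //=; last by lia.
rewrite big_mkord (@big_ltn _ _ _ k.+1) //= [X in _ + (_ + X)]big1_seq ?addr0.
  rewrite /greedy_chi ltnn eqxx sqrrN expr1n sylvester_greedy_dim -sum_greedy_dim.
  rewrite intS [RHS]addrC; congr (_ + _); rewrite -[RHS]natz natr_sum.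
  by apply: eq_bigr => j _; rewrite (ltn_ord j) natrX natz.
move=> i /andP[_]; rewrite mem_index_iota => /andP[ki _].
by rewrite /greedy_chi ltnNge (ltnW ki) (gtn_eqF ki) expr0n.
Qed.

Lemma greedy_codegree (C : numClosedFieldType) (R : fusion_ring) (n k : nat) :
  fusion_isomorphic R (greedy_ring n) -> (k < n)%N ->
  is_formal_codegree R ((sylvester k)%:R : C).
Proof.
move=> [f [s [_ s_bij fE]]] kn.
pose e (x : R) : C := (greedy_ev k.+1 (f x))%:~R.
have ze : zmod_morphism e.
  move=> x y; rewrite /e raddfB -[RHS]rmorphB; congr (_%:~R); rewrite /greedy_ev.
  by rewrite -sumrB; apply: eq_bigr => j _; rewrite -mulrBl /greedy_vec !mxE.
have me : monoid_morphism e.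
  split; first by rewrite /e rmorph1 greedy_ev_basis.
  by move=> x y; rewrite /e rmorphM greedy_evM // rmorphM.
pose chi : {rmorphism R -> C} := HB.pack e
  (GRing.isZmodMorphism.Build _ _ _ ze) (GRing.isMonoidMorphism.Build _ _ _ me).
have chiE i : chi (fus_basis i) = (greedy_chi k.+1 (s i))%:~R.
  by rewrite /= /e fE greedy_ev_basis.
have normE i : chi (fus_basis i) * chi (fus_basis (fus_dual i))
    = (greedy_chi k.+1 (s i) ^+ 2)%:~R.
  by rewrite -fus_starE character_star chiE rmorph_int rmorphXn /= expr2.
suff <- : fus_pairing chi chi = (sylvester k)%:R by exact: character_codegree.
rewrite -[RHS]/((sylvester k : int)%:~R) -(sum_greedy_chi_sqr kn) rmorph_sum.
rewrite [RHS](reindex s) /=; last exact: onW_bij.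
by apply: eq_bigr => i _; exact: normE.
Qed.

Section FromCodegrees.
Variables (C : numClosedFieldType) (R : fusion_ring) (n : nat).
Hypothesis rankR : fus_rank R = n.+1.
Local Notation N := (greedy_dim n.+1).

Lemma characters_of_codegrees :
  (forall k, (k < n)%N -> is_formal_codegree (C := C) R (sylvester k)%:R) ->
  exists (chi : 'I_n -> {rmorphism R -> C}) (psi : {rmorphism R -> C}),
  [/\ forall k, fus_pairing (chi k) (chi k) = (sylvester k)%:R,
      forall k, fus_pairing (chi k) psi = 0, fus_pairing psi psi = N%:R &
      forall x, (fus_tr x)%:~R =
        psi x / N%:R + \sum_k chi k x / (sylvester k)%:R].
Proof.
move=> codeg; pose a (k : 'I_n) : C := (sylvester k)%:R.
have a_inj : injective a.
  by move=> k l /eqP; rewrite eqr_nat => /eqP/sylvester_inj e; apply: val_inj.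
have a0 k : a k != 0 by exact: sylvester_neq0.
have [chi chiE] :=
  linear_characters a_inj a0 (fun k => codeg k (ltn_ord k)) rankR.
have [psi [trE orth psiE]] := last_character rankR a_inj a0
  (greedy_dim_neq0 C n.+1) (sum_inv_sylvester C n) chiE.
by exists chi, psi.
Qed.

Lemma greedy_of_codegrees : (1 < n)%N ->
  (forall k, (k < n)%N -> is_formal_codegree (C := C) R (sylvester k)%:R) ->
  fusion_isomorphic R (greedy_ring n).
Proof.
move=> n1 /characters_of_codegrees[chi [psi [chiE orth psiE trE]]].
pose X (j : option 'I_n) := if j is Some k then chi k else psi.
pose f (j : option 'I_n) : int := if j is Some k then sylvester k else N.
have f_gt0 j : 0 < f j.
  by case: j => [k|] /=; rewrite ltz_nat ?greedy_dim_gt0 // ltnW ?sylvester_gt1.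
have f2 j : j != None -> f j *+ 2 <= f None.
  case: j => // k _ /=; rewrite -mulr_natr natz -PoszM lez_nat.
  exact: greedy_dim_sylvester_le.
have f_inj : injective f.
  have lt k : f (Some k) < f None.
    by have := f2 (Some k) isT; have := f_gt0 (Some k); rewrite mulr2n; lia.
  case=> [k|] [l|] // e; first congr Some.
    by apply/val_inj/sylvester_inj/eqP; rewrite -eqz_nat; apply/eqP.
    by have := lt k; rewrite e ltxx.
  by have := lt l; rewrite e ltxx.
have XE j : fus_pairing (X j) (X j) = (f j)%:~R by case: j => [k|] /=.
have trX x : (fus_tr x)%:~R = \sum_j X j x / (f j)%:~R.
  rewrite trE (bigD1 None) //= (reindex_omap Some id) /=; last by case.
  by congr (_ + _); apply: eq_big => // k; rewrite eqxx.
have [x xE] : exists x : option 'I_n -> fus_idx R -> int,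
    forall j i, X j (fus_basis i) = (x j i)%:~R.
  apply: (@fin_all_exists _ (fun=> fus_idx R -> int)
    (fun j x => forall i, X j (fus_basis i) = (x i)%:~R)) => j.
  apply: (@fin_all_exists _ (fun=> int) (fun i z => X j (fus_basis i) = z%:~R))
    => i.
  exact: (split_character_int XE trX j (fus_basis i) f_inj).
have xD j i : X j (fus_basis (fus_dual i)) = (x j i)%:~R.
  by rewrite -fus_starE character_star xE rmorph_int.
have := @greedy_table C n _ (fus_one R) (fun k => x (Some k)) (x None) rankR.
case.
- move=> k; apply: (@intr_inj C); by rewrite -xE fus_oneE rmorph1.
- apply: (@intr_inj C); by rewrite -xE fus_oneE rmorph1.
- move=> i; apply: (dominant_character_ge0 XE trX (x := x^~ i)) => //.
- move=> k; apply: (@intr_inj C); rewrite -[RHS]chiE rmorph_sum.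
  apply: eq_bigr => i _.
  by rewrite (xE (Some k)) (xD (Some k)) rmorphXn /= expr2.
- move=> k; apply: (@intr_inj C); rewrite rmorph0 -(orth k) rmorph_sum.
  by apply: eq_bigr => i _; rewrite (xE (Some k)) (xD None) rmorphM.
- move=> i /negbTE i1; have := trE (fus_basis i).
  rewrite fus_tr_basis i1 addrC (xE None) => e; rewrite [RHS]e; congr (_ + _).
  by apply: eq_bigr => k _; rewrite (xE (Some k)).
- move=> i; have := trE (fus_basis i * fus_basis (fus_dual i)).
  rewrite fus_tr_mul eqxx addrC rmorphM /= (xE None) (xD None) => e.
  rewrite [RHS]e expr2; congr (_ + _); apply: eq_bigr => k _.
  by rewrite rmorphM /= (xE (Some k)) (xD (Some k)) expr2.
move=> t [t_bij tP]; apply: (fusion_isomorphic_of_table (C := C) t_bij).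
move=> m m0; have [mn|nm] := leqP m n.
  case: m m0 mn => // m _ mn; exists (chi (Ordinal mn)) => j.
  by rewrite (xE (Some _)); have [_ ->] := tP j.
exists psi => j; rewrite (xE None); have [-> _] := tP j.
by rewrite /greedy_chi (leq_trans (ltn_ord j)).
Qed.

(** Here the two codegrees are both 2, so neither integrality nor the sign of the
    last character can be read off the codegrees. The values of the two
    characters at the nontrivial basis element are [1] and [-1], in an order that
    is immaterial. *)
Lemma greedy_of_codegree_two : n = 1%N ->
  is_formal_codegree (C := C) R 2%:R -> fusion_isomorphic R (greedy_ring n).
Proof.
move=> n1 codeg.
have /characters_of_codegrees[chi [psi [chiE orth psiE trE]]] :
    forall k, (k < n)%N -> is_formal_codegree (C := C) R (sylvester k)%:R.
  by rewrite n1 => -[|k] //; rewrite sylvester0.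
subst n; have [b b1] : exists b, b != fus_one R.
  apply/existsP; apply: contra_eqT rankR => /existsPn all1.
  rewrite /fus_rank -sum1_card (bigD1 (fus_one R)) //= big1 //.
  by move=> b; rewrite (negPf (all1 b)).
have bP i : i != fus_one R -> i = b.
  move=> i1; apply/eqP; apply: contra_eqT rankR => ib.
  rewrite /fus_rank -sum1_card (bigD1 (fus_one R)) //= (bigD1 b) //=.
  by rewrite (bigD1 i) //= i1.
have bb : fus_dual b = b.
  by apply: bP; rewrite -(dual_one R) (inj_eq (@dual_inj R)).
have chib : chi ord0 (fus_basis b) ^+ 2 = 1.
  have := chiE ord0; rewrite sylvester0 /fus_pairing (bigD1 (fus_one R)) //=.
  rewrite (bigD1 b) //= big1 ?addr0; last first.
    by move=> i /andP[/bP ->]; rewrite eqxx.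
  rewrite dual_one fus_oneE rmorph1 mulr1 bb -expr2 => e.
  by apply: (addrI 1); rewrite e.
have psib : psi (fus_basis b) = - chi ord0 (fus_basis b).
  have := trE (fus_basis b); rewrite fus_tr_basis (negPf b1) big_ord1 sylvester0.
  have -> : greedy_dim 2 = 2%N by rewrite greedy_dimSS /greedy_dim sylvester0.
  rewrite -mulrDl => /esym/eqP; rewrite mulf_eq0 invr_eq0 pnatr_eq0 orbF.
  by rewrite addr_eq0 => /eqP.
have [X [Y [Xb Yb]]] : exists X Y : {rmorphism R -> C},
    X (fus_basis b) = -1 /\ Y (fus_basis b) = 1.
  move/eqP: chib; rewrite sqrf_eq1 => /orP[] /eqP c.
    by exists psi, (chi ord0); rewrite psib c.
  by exists (chi ord0), psi; rewrite psib c opprK.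
pose t (j : 'I_2) := if j == ord0 then fus_one R else b.
have t_bij : bijective t.
  apply: inj_card_bij; last by rewrite card_ord [#|_|]rankR.
  move=> i j; rewrite /t; case: (unliftP ord0 i) => [i'|] ->;
    case: (unliftP ord0 j) => [j'|] -> //=.
  - by rewrite (ord1 i') (ord1 j').
  - by move=> e; rewrite e eqxx in b1.
  - by move=> e; rewrite -e eqxx in b1.
apply: (fusion_isomorphic_of_table (C := C) t_bij) => -[|[|m]] // _.
  exists X => j; rewrite /t; case: (unliftP ord0 j) => [j'|] -> /=.
    by rewrite (ord1 j').
  by rewrite fus_oneE rmorph1.
exists Y => j; rewrite /t; case: (unliftP ord0 j) => [j'|] -> /=.
  by rewrite (ord1 j') /greedy_chi -[greedy_dim _]/(sylvester 0 - 1)%N sylvester0.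
by rewrite fus_oneE rmorph1.
Qed.
End FromCodegrees.

Theorem corollary1 (K : realType) (n : nat) (n_ge1 : (1 <= n)%N)
    (R : fusion_ring) (rankR : fus_rank R = n.+1) :
  (forall k : nat, (k < n)%N ->
     is_formal_codegree (C := K[i]) R (sylvester k)%:R)
  <-> fusion_isomorphic R (greedy_ring n).
Proof.
split=> [codeg|iso k kn]; last exact: greedy_codegree iso kn.
have [n1|n_gt1|n1] := ltngtP 1 n; first exact: greedy_of_codegrees codeg.
  by rewrite ltnNge n_ge1 in n_gt1.
apply: (greedy_of_codegree_two rankR (esym n1)).
by rewrite -sylvester0; apply: codeg.
Qed.
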